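(* Let $\alpha=\frac{1-i}{2}\in\mathbb{C}$, and let $G:[0,1]\to\mathbb{C}$ be the unique continuous solution of the functional equation $$G(x)=\begin{cases}\alpha\, G(2x)-\frac12, & 0\le x<\frac12,\\[2pt] (1-\alpha)\,G(2x-1)+\frac12, & \frac12\le x\le 1.\end{cases}$$ Then for every $x\in[0,1]$, $$G(x)=\frac12\sum_{n=1}^{\infty}(-1)^{1-\omega_n(x)}\,\alpha^{\,n-1-q(x,n-1)}\,(1-\alpha)^{q(x,n-1)}.$$
   Context: For $x\in[0,1]$, the binary expansion of $x$ is $x=\sum_{n=1}^\infty \omega_n(x)2^{-n}=(0.\omega_1\omega_2\cdots)_2$ with $\omega_n(x)\in\{0,1\}$. If $x$ has two binary expansions, the one with trailing zeros is chosen, except that for $x=1$ one sets $\omega_n(1)=1$ for every $n$. For $n\ge 1$, $q(x,n)=\sum_{k=1}^n\omega_k(x)$ is the number of $1$'s among the first $n$ binary digits of $x$, and $q(x,0)=0$. Here $i$ is the imaginary unit. The functional equation in the claim has exactly one continuous solution $G:[0,1]\to\mathbb{C}$. *)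

(* Defs.v *)
From Stdlib Require Export Reals List.
From Stdlib Require Import Lra Lia ClassicalEpsilon.
From Coquelicot Require Export Coquelicot.
Open Scope R_scope.

(* Digit sequences are indexed from 1: the value at index 0 is irrelevant. *)
Definition binary_expansion (w : nat -> nat) (x : R) : Prop :=
  (forall n, (1 <= n)%nat -> w n = 0%nat \/ w n = 1%nat) /\
  is_series (fun k => INR (w (S k)) / 2 ^ S k) x.

Definition chosen_expansion (w : nat -> nat) (x : R) : Prop :=
  binary_expansion w x /\
  (x <> 1 ->
   (exists v, binary_expansion v x /\ exists n, (1 <= n)%nat /\ v n <> w n) ->
   exists N, forall n, (N <= n)%nat -> w n = 0%nat) /\
  (x = 1 -> forall n, (1 <= n)%nat -> w n = 1%nat).

(* [omega x n] is meaningful for [0 <= x <= 1] and [1 <= n]; it is then pinned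
   down by [omega_spec] and [chosen_expansion_unique] below. *)
Definition omega (x : R) : nat -> nat :=
  epsilon (inhabits (fun _ => 0%nat)) (fun w => chosen_expansion w x).

Definition q (x : R) (n : nat) : nat := list_sum (map (omega x) (seq 1 n)).

Definition alpha : C := ((1 - Ci) / 2)%C.

(* [rem w x n = 2 ^ n * (x - sum_(k = 1..n) w k / 2 ^ k)] *)
Fixpoint rem (w : nat -> nat) (x : R) (n : nat) : R :=
  match n with
  | O => x
  | S m => 2 * rem w x m - INR (w (S m))
  end.

Lemma is_series_eq (a b : nat -> R) (l m : R) :
  is_series a l -> (forall n, a n = b n) -> l = m -> is_series b m.
Proof. intros H E <-. exact (is_series_ext a b l E H). Qed.

Lemma is_series_half : is_series (fun k => 1 / 2 ^ S k) 1.
Proof.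
assert (H : is_series (fun k => (1/2) ^ k) (/ (1 - 1/2))).
{ apply is_series_geom. rewrite Rabs_pos_eq; lra. }
apply (is_series_scal_l (1/2)) in H.
apply (is_series_eq _ _ _ _ H);
  [intros n|]; unfold scal; simpl; unfold mult; simpl; [|field].
replace (1/2) with (/2) by lra. rewrite pow_inv. field.
apply pow_nonzero; lra.
Qed.

Lemma digit_bound w x n : binary_expansion w x -> 0 <= INR (w (S n)) <= 1.
Proof.
intros [Hd _]. destruct (Hd (S n)) as [E|E]; try lia; rewrite E; simpl; lra.
Qed.

Lemma expansion_bounds w x : binary_expansion w x -> 0 <= x <= 1.
Proof.
intros H. assert (B := fun n => digit_bound w x n H). destruct H as [_ Hs].
assert (P : forall k, 0 < / 2 ^ S k) by (intros k; apply Rinv_0_lt_compat, pow_lt; lra).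
rewrite <- (is_series_unique _ _ Hs).
split.
- apply Rle_trans with (Series (fun _ => 0)).
  + right. symmetry. apply is_series_unique.
    apply (is_series_eq _ _ _ _ (is_series_scal_l 0 _ _ is_series_half));
      [intros n|]; unfold scal; simpl; unfold mult; simpl; ring.
  + apply Series_le; [|exists x; exact Hs].
    intros n. specialize (B n); specialize (P n).
    split; [lra|]. apply Rmult_le_pos; lra.
- rewrite <- (is_series_unique _ _ is_series_half).
  apply Series_le; [|exists 1; exact is_series_half].
  intros n. specialize (B n); specialize (P n).
  unfold Rdiv. split; [apply Rmult_le_pos; lra|].
  apply Rmult_le_compat_r; lra.
Qed.

Lemma expansion_shift w x :
  binary_expansion w x ->
  binary_expansion (fun n => w (S n)) (2 * x - INR (w 1%nat)).
Proof.
intros [Hd Hs]. split; [intros n Hn; apply Hd; lia|].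
assert (Ht : is_series (fun k => INR (w (S (S k))) / 2 ^ S (S k)) (x - INR (w 1%nat) / 2)).
{ apply (is_series_incr_1 (fun k => INR (w (S k)) / 2 ^ S k)).
  apply (is_series_eq _ _ _ _ Hs); [reflexivity|].
  unfold plus; simpl; field. }
apply (is_series_scal_l 2) in Ht.
apply (is_series_eq _ _ _ _ Ht);
  [intros n|]; unfold scal, plus, opp; simpl; unfold mult; simpl; field.
apply pow_nonzero; lra.
Qed.

Lemma rem_shift w x n :
  rem (fun n => w (S n)) (2 * x - INR (w 1%nat)) n = rem w x (S n).
Proof.
induction n as [|n IH]; [reflexivity|].
cbn [rem] in *. rewrite IH. reflexivity.
Qed.

Lemma rem_bounds w x n : binary_expansion w x -> 0 <= rem w x n <= 1.
Proof.
revert w x; induction n as [|n IH]; intros w x H.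
- exact (expansion_bounds w x H).
- rewrite <- rem_shift. apply IH, expansion_shift, H.
Qed.

Lemma rem_partial w x n :
  sum_n (fun k => INR (w (S k)) / 2 ^ S k) n = x - rem w x (S n) / 2 ^ S n.
Proof.
induction n as [|n IH].
- rewrite sum_O. simpl. field.
- rewrite sum_Sn, IH. unfold plus; simpl. field. apply pow_nonzero; lra.
Qed.

Lemma expansion_of_rem w x :
  (forall n, (1 <= n)%nat -> w n = 0%nat \/ w n = 1%nat) ->
  (forall n, 0 <= rem w x n <= 1) -> binary_expansion w x.
Proof.
intros Hd Hr. split; [exact Hd|].
change (is_lim_seq (sum_n (fun k => INR (w (S k)) / 2 ^ S k)) x).
assert (L : is_lim_seq (fun n => (1/2) ^ S n) 0).
{ apply (is_lim_seq_incr_1 (fun n => (1/2) ^ n)), is_lim_seq_geom.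
  rewrite Rabs_pos_eq; lra. }
assert (E : forall n, (1/2) ^ S n = / 2 ^ S n).
{ intros n. replace (1/2) with (/2) by lra. apply pow_inv. }
apply (is_lim_seq_le_le (fun n => x - (1/2) ^ S n) _ (fun _ => x)).
- intros n. rewrite (rem_partial w x), E. specialize (Hr (S n)).
  assert (0 < / 2 ^ S n) by (apply Rinv_0_lt_compat, pow_lt; lra).
  unfold Rdiv. split; nra.
- replace (Finite x) with (Finite (x - 0)) by (f_equal; ring).
  apply is_lim_seq_minus'; [apply is_lim_seq_const|exact L].
- apply is_lim_seq_const.
Qed.

Lemma rem_ext v w x n :
  (forall m, (1 <= m <= n)%nat -> v m = w m) -> rem v x n = rem w x n.
Proof.
induction n as [|n IH]; intros H; [reflexivity|].
cbn [rem]. rewrite IH, H; [reflexivity|lia|intros; apply H; lia].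
Qed.

Lemma rem_zero w x n :
  binary_expansion w x -> rem w x n = 0 ->
  forall m, (n < m)%nat -> w m = 0%nat.
Proof.
intros H H0.
assert (A : forall m, rem w x (n + m) = 0).
{ induction m as [|m IH]; [now rewrite Nat.add_0_r|].
  rewrite Nat.add_succ_r. pose proof (rem_bounds w x (S (n + m)) H) as B.
  pose proof (digit_bound w x (n + m) H). cbn [rem] in *. lra. }
intros m Hm. specialize (A (m - n)%nat) as A1. specialize (A (m - n - 1)%nat).
replace (n + (m - n))%nat with (S (m - 1)) in A1 by lia.
replace (n + (m - n - 1))%nat with (m - 1)%nat in A by lia.
cbn [rem] in A1. replace (S (m - 1)) with m in A1 by lia.
apply INR_eq. simpl. lra.
Qed.

Lemma rem_one w x n :
  binary_expansion w x -> rem w x n = 1 ->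
  forall m, (n < m)%nat -> w m = 1%nat.
Proof.
intros H H0.
assert (A : forall m, rem w x (n + m) = 1).
{ induction m as [|m IH]; [now rewrite Nat.add_0_r|].
  rewrite Nat.add_succ_r. pose proof (rem_bounds w x (S (n + m)) H) as B.
  pose proof (digit_bound w x (n + m) H). cbn [rem] in *. lra. }
intros m Hm. specialize (A (m - n)%nat) as A1. specialize (A (m - n - 1)%nat).
replace (n + (m - n))%nat with (S (m - 1)) in A1 by lia.
replace (n + (m - n - 1))%nat with (m - 1)%nat in A by lia.
cbn [rem] in A1. replace (S (m - 1)) with m in A1 by lia.
apply INR_eq. simpl. lra.
Qed.

Lemma first_difference (v w : nat -> nat) :
  (exists n, (1 <= n)%nat /\ v n <> w n) ->
  exists n, v (S n) <> w (S n) /\ forall m, (1 <= m <= n)%nat -> v m = w m.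
Proof.
intros [n [Hn Hvw]]. revert Hn Hvw.
induction n as [n IH] using (well_founded_induction Wf_nat.lt_wf).
intros Hn Hvw. destruct n as [|n]; [lia|].
destruct (excluded_middle_informative
            (exists m, (1 <= m <= n)%nat /\ v m <> w m)) as [[m [Hm E]]|F].
- apply (IH m); [lia|lia|exact E].
- exists n. split; [exact Hvw|]. intros m Hm.
  destruct (Nat.eq_dec (v m) (w m)) as [E|E]; [exact E|].
  exfalso. apply F. exists m. auto.
Qed.

Lemma two_expansions v w x :
  binary_expansion v x -> binary_expansion w x ->
  (exists n, (1 <= n)%nat /\ v n <> w n) ->
  exists n, (rem v x n = 0 /\ rem w x n = 1) \/ (rem v x n = 1 /\ rem w x n = 0).
Proof.
intros Hv Hw D. destruct (first_difference v w D) as [n [E F]].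
exists (S n).
pose proof (rem_bounds v x (S n) Hv) as Bv. pose proof (rem_bounds w x (S n) Hw) as Bw.
cbn [rem] in *. rewrite (rem_ext v w x n F) in *.
destruct Hv as [Dv _]. destruct Hw as [Dw _].
destruct (Dv (S n)) as [V|V]; [lia| |];
  (destruct (Dw (S n)) as [W|W]; [lia| |]); rewrite V, W in *; simpl in *;
  try congruence; lra.
Qed.

Lemma chosen_expansion_unique x v w :
  chosen_expansion v x -> chosen_expansion w x ->
  forall n, (1 <= n)%nat -> v n = w n.
Proof.
intros (Hv & Zv & Ov) (Hw & Zw & Ow) n Hn.
destruct (Req_dec x 1) as [E|E].
{ rewrite Ov, Ow; auto. }
destruct (Nat.eq_dec (v n) (w n)) as [D|D]; [exact D|exfalso].
destruct (Zv E) as [N HN].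
{ exists w. split; [exact Hw|]. exists n. auto. }
destruct (Zw E) as [M HM].
{ exists v. split; [exact Hv|]. exists n. auto. }
destruct (two_expansions v w x Hv Hw) as [m [[_ A]|[A _]]].
{ exists n. auto. }
- specialize (rem_one w x m Hw A (S (m + M))) as C.
  rewrite HM in C by lia. discriminate C; lia.
- specialize (rem_one v x m Hv A (S (m + N))) as C.
  rewrite HN in C by lia. discriminate C; lia.
Qed.

Fixpoint greedy_rem (x : R) (n : nat) : R :=
  match n with
  | O => x
  | S m => let t := greedy_rem x m in
           if Rlt_dec t (1/2) then 2 * t else 2 * t - 1
  end.

Definition greedy_digit (x : R) (n : nat) : nat :=
  if Rlt_dec (greedy_rem x (pred n)) (1/2) then 0%nat else 1%nat.

Lemma greedy_rem_bounds x n : 0 <= x < 1 -> 0 <= greedy_rem x n < 1.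
Proof.
intros H; induction n as [|n IH]; [exact H|].
simpl. destruct (Rlt_dec (greedy_rem x n) (1/2)); lra.
Qed.

Lemma rem_greedy x n : rem (greedy_digit x) x n = greedy_rem x n.
Proof.
induction n as [|n IH]; [reflexivity|].
simpl. rewrite IH. unfold greedy_digit; simpl.
destruct (Rlt_dec (greedy_rem x n) (1/2)); simpl; lra.
Qed.

Lemma chosen_expansion_exists x :
  0 <= x <= 1 -> exists w, chosen_expansion w x.
Proof.
intros Hx. destruct (Req_dec x 1) as [E|E].
- exists (fun _ => 1%nat). split; [|split; [contradiction|reflexivity]].
  split; [auto|]. rewrite E. exact is_series_half.
- assert (Hx' : 0 <= x < 1) by lra.
  assert (Hw : binary_expansion (greedy_digit x) x).
  { apply expansion_of_rem.
    - intros n _. unfold greedy_digit.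
      destruct (Rlt_dec (greedy_rem x (pred n)) (1/2)); auto.
    - intros n. rewrite rem_greedy. pose proof (greedy_rem_bounds x n Hx'). lra. }
  exists (greedy_digit x). split; [exact Hw|]. split; [|contradiction].
  intros _ [v [Hv D]].
  destruct (two_expansions v (greedy_digit x) x Hv Hw D) as [n [[_ A]|[_ A]]].
  + rewrite rem_greedy in A. pose proof (greedy_rem_bounds x n Hx'). lra.
  + exists (S n). intros m Hm. apply (rem_zero _ x n Hw A). lia.
Qed.

Lemma omega_spec x : 0 <= x <= 1 -> chosen_expansion (omega x) x.
Proof.
intros Hx. unfold omega. apply epsilon_spec, chosen_expansion_exists, Hx.
Qed.

(* Main.v *)
Require Import Defs.
From Stdlib Require Import Reals.
From Coquelicot Require Import Coquelicot.
From Stdlib Require Import List Lra Lia.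
Open Scope R_scope.

(** Write [r n = rem (omega x) x n] for the image of [x] under [n] steps of the
doubling map, so that [r n] has the binary digits of [x] from position [n + 1]
on.  The digit [omega x (n + 1)] tells in which half of the unit interval
[r n] lies, hence which branch of the functional equation applies there:
<<
  G (r n) = c * G (r (n + 1)) + (-1) ^ (1 - omega x (n + 1)) / 2,
>>
with [c = alpha] for the digit 0 and [c = 1 - alpha] for the digit 1.
The product of the first [n] factors [c] is [weight x n].  Iterating from
[r 0 = x] shows that [G x] is half of the sum of the first [n] terms plus
[weight x n * G (r n)] ([finite_expansion]).  Since [alpha]
and [1 - alpha] both have modulus [sqrt (1/2) < 1], and [G] is bounded on
[[0, 1]] by continuity, this remainder tends to 0.

The delicate point is [r n = 1/2], where the second branch is in force, so that
the next digit has to be 1.  The digit 0 would force [r (n + 1) = 1] and an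
infinite tail of ones, which the choice of expansion excludes when [x < 1]
([rem_omega_lt_1]). *)

(** * Binary digits and the doubling map *)

Lemma greedy_binary_expansion x :
  0 <= x < 1 -> binary_expansion (greedy_digit x) x.
Proof.
intros Hx. apply expansion_of_rem.
- intros n _. unfold greedy_digit.
  destruct (Rlt_dec (greedy_rem x (pred n)) (1/2)); auto.
- intros n. rewrite rem_greedy. pose proof (greedy_rem_bounds x n Hx). lra.
Qed.

(** A remainder 1 means that all later digits of [omega x] are ones.  The greedy
expansion of [x], whose remainders stay below 1, is then a second expansion,
and the one chosen must end in zeros. *)
Lemma rem_omega_lt_1 x n : 0 <= x < 1 -> rem (omega x) x n < 1.
Proof.
intros Hx.
destruct (omega_spec x) as (Hw & Z & _); [lra|].
pose proof (rem_bounds _ x n Hw) as B.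
destruct (Req_dec (rem (omega x) x n) 1) as [E|E]; [exfalso|lra].
destruct Z as [N HN]; [lra| |].
- exists (greedy_digit x). split; [apply greedy_binary_expansion, Hx|].
  destruct (Classical_Prop.classic
    (exists m, (1 <= m)%nat /\ greedy_digit x m <> omega x m)) as [D|D];
    [exact D|exfalso].
  assert (E' : rem (greedy_digit x) x n = rem (omega x) x n).
  { apply rem_ext. intros m Hm.
    destruct (Nat.eq_dec (greedy_digit x m) (omega x m)) as [F|F]; [exact F|].
    exfalso. apply D. exists m. split; [lia|exact F]. }
  rewrite rem_greedy in E'. pose proof (greedy_rem_bounds x n Hx). lra.
- pose proof (rem_one _ x n Hw E (S (n + N)) ltac:(lia)) as H1.
  rewrite HN in H1 by lia. discriminate H1.
Qed.

(** The digit 0 leaves [2 * rem (omega x) x n] as the next remainder, and the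
digit 1 leaves [2 * rem (omega x) x n - 1]; that these lie in the unit interval
gives the bounds, except for the strict one. *)
Lemma omega_cases x n :
  0 <= x <= 1 ->
  (omega x (S n) = 0%nat /\ 0 <= rem (omega x) x n < 1/2) \/
  (omega x (S n) = 1%nat /\ 1/2 <= rem (omega x) x n <= 1).
Proof.
intros Hx. destruct (omega_spec x Hx) as (Hw & _ & O).
pose proof (rem_bounds _ x n Hw) as B.
pose proof (rem_bounds _ x (S n) Hw) as B'. cbn [rem] in B'.
destruct (proj1 Hw (S n)) as [E|E]; [lia| |]; rewrite E in B'; simpl in B'.
- left. split; [exact E|].
  destruct (Req_dec x 1) as [X|X].
  + rewrite (O X) in E by lia. discriminate E.
  + pose proof (rem_omega_lt_1 x (S n) ltac:(lra)) as L.
    cbn [rem] in L. rewrite E in L. simpl in L. lra.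
- right. split; [exact E|]. lra.
Qed.

Lemma q_S x n : q x (S n) = (q x n + omega x (S n))%nat.
Proof.
unfold q. rewrite seq_S, map_app, list_sum_app. simpl. lia.
Qed.

Lemma q_le x n : 0 <= x <= 1 -> (q x n <= n)%nat.
Proof.
intros Hx. induction n as [|n IH]; [apply Nat.le_refl|].
rewrite q_S. destruct (omega_cases x n Hx) as [[E _]|[E _]]; rewrite E; lia.
Qed.

(** * Weights *)

Definition weight (x : R) (n : nat) : C :=
  (alpha ^ (n - q x n) * (1 - alpha) ^ q x n)%C.

Lemma weight_S_0 x n :
  0 <= x <= 1 -> omega x (S n) = 0%nat ->
  weight x (S n) = (weight x n * alpha)%C.
Proof.
intros Hx E. pose proof (q_le x n Hx). unfold weight. rewrite q_S, E, Nat.add_0_r.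
replace (S n - q x n)%nat with (S (n - q x n)) by lia.
rewrite Cpow_S. ring.
Qed.

Lemma weight_S_1 x n :
  omega x (S n) = 1%nat -> weight x (S n) = (weight x n * (1 - alpha))%C.
Proof.
intros E. unfold weight. rewrite q_S, E.
replace (S n - (q x n + 1))%nat with (n - q x n)%nat by lia.
replace (q x n + 1)%nat with (S (q x n)) by lia.
rewrite Cpow_S. ring.
Qed.

Lemma alpha_eq : alpha = (1/2, - (1/2)).
Proof. unfold alpha. apply injective_projections; simpl; field. Qed.

Lemma Cmod_alpha : Cmod alpha = sqrt (1/2).
Proof. rewrite alpha_eq. unfold Cmod; simpl. f_equal. field. Qed.

Lemma Cmod_one_minus_alpha : Cmod (1 - alpha) = sqrt (1/2).
Proof. rewrite alpha_eq. unfold Cmod; simpl. f_equal. field. Qed.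

Lemma Cmod_weight x n : 0 <= x <= 1 -> Cmod (weight x n) = sqrt (1/2) ^ n.
Proof.
intros Hx. unfold weight.
rewrite Cmod_mult, !Cmod_pow, Cmod_alpha, Cmod_one_minus_alpha, <- pow_add.
f_equal. pose proof (q_le x n Hx). lia.
Qed.

(** * Boundedness on a compact interval *)

(** Precomposition with the projection of the line onto [[a, b]] turns
continuity relative to the interval into continuity at each of its points. *)
Lemma continuous_on_interval_bounded {K : AbsRing} {V : NormedModule K}
  (f : R -> V) (a b : R) :
  a <= b -> continuous_on (fun x => a <= x <= b) f ->
  exists M, forall x, a <= x <= b -> norm (f x) <= M.
Proof.
intros Hab Hf.
set (p := fun x => Rmax a (Rmin b x)).
assert (pE : forall x, a <= x <= b -> p x = x).
{ intros x Hx. unfold p. rewrite Rmin_right, Rmax_right; lra. }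
assert (pD : forall x, a <= p x <= b).
{ intros x. unfold p, Rmax, Rmin.
  destruct (Rle_dec b x); destruct Rle_dec; lra. }
destruct (bounded_continuity (fun x => f (p x)) a b) as [M HM].
- intros x Hx.
  apply (filterlim_comp _ _ _ p f _ (within (fun x => a <= x <= b) (locally (p x)))).
  + intros P [e He]. exists e. intros y Hy.
    apply (He (p y)); [|apply pD].
    (* the projection onto the interval is 1-Lipschitz *)
    unfold ball in *; simpl in *; unfold AbsRing_ball, abs, minus, plus, opp in *;
      simpl in *.
    apply Rabs_def2 in Hy. apply Rabs_def1; unfold p, Rmax, Rmin;
      repeat destruct Rle_dec; lra.
  + apply Hf, pD.
- exists M. intros x Hx. specialize (HM x Hx). simpl in HM.
  rewrite (pE x Hx) in HM. lra.
Qed.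

(** * The expansion of [G] *)

Section Expansion.

Variable G : R -> C.
Hypothesis G_left : forall x : R, 0 <= x < 1 / 2 ->
  G x = (alpha * G (2 * x)%R - 1 / 2)%C.
Hypothesis G_right : forall x : R, 1 / 2 <= x <= 1 ->
  G x = ((1 - alpha) * G (2 * x - 1)%R + 1 / 2)%C.

(** One step of the iteration.  The factor [weight x n] makes these identities
telescope: it turns the leading coefficient of the right-hand side into
[weight x (S n)]. *)
Lemma functional_equation_rem x n :
  0 <= x <= 1 ->
  (weight x n * G (rem (omega x) x n) =
   1 / 2 * ((- (1)) ^ (1 - omega x (S n)) * weight x n) +
   weight x (S n) * G (rem (omega x) x (S n)))%C.
Proof.
intros Hx. cbn [rem].
destruct (omega_cases x n Hx) as [[E B]|[E B]].
- rewrite (weight_S_0 x n Hx E), E, (G_left _ B). simpl INR.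
  rewrite Rminus_0_r, Cpow_1_r. unfold Cdiv. ring.
- rewrite (weight_S_1 x n E), E, (G_right _ B). simpl INR.
  change ((- (1)) ^ (1 - 1))%C with (RtoC 1). unfold Cdiv. ring.
Qed.

Lemma finite_expansion x n :
  0 <= x <= 1 ->
  (G x = 1 / 2 * sum_n (fun k => (- (1)) ^ (1 - omega x (S k)) * weight x k) n
         + weight x (S n) * G (rem (omega x) x (S n)))%C.
Proof.
intros Hx. induction n as [|n IH].
- rewrite sum_O, <- functional_equation_rem by exact Hx.
  cbn [rem]. unfold weight; simpl. ring.
- rewrite sum_Sn, IH at 1. rewrite (functional_equation_rem x (S n) Hx).
  unfold plus; simpl. ring.
Qed.

(** The error of the partial sums is [2 * weight x (S n) * G (rem _ x (S n))],
in which the weight has modulus [sqrt (1/2) ^ S n]. *)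
Lemma expansion_series M x :
  (forall y, 0 <= y <= 1 -> Cmod (G y) <= M) -> 0 <= x <= 1 ->
  is_series (fun k => (- (1)) ^ (1 - omega x (S k)) * weight x k)%C (2 * G x)%C.
Proof.
intros HM Hx.
assert (L : is_lim_seq (fun n => 2 * (sqrt (1/2) ^ S n * M)) 0).
{ assert (Hs : sqrt (1/2) < 1).
  { rewrite <- sqrt_1 at 2. apply sqrt_lt_1; lra. }
  replace (Finite 0) with (Rbar_mult 2 (Rbar_mult 0 M))
    by (simpl; f_equal; ring).
  apply is_lim_seq_scal_l, is_lim_seq_scal_r.
  apply (is_lim_seq_incr_1 (fun n => sqrt (1/2) ^ n)), is_lim_seq_geom.
  rewrite Rabs_pos_eq; [exact Hs|apply sqrt_pos]. }
apply filterlim_locally_ball_norm. intros eps.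
apply is_lim_seq_spec in L. destruct (L eps) as [N HN].
exists N. intros n Hn. specialize (HN n Hn).
apply Rle_lt_trans with (2 * (sqrt (1/2) ^ S n * M));
  [|apply Rabs_def2 in HN; lra].
assert (A : forall u v : C, (u - 2 * (1 / 2 * u + v) = - (2 * v))%C)
  by (intros u v; field).
rewrite (finite_expansion x n Hx).
eapply Rle_trans; [apply Req_le, (f_equal Cmod), A|].
rewrite Cmod_opp, !Cmod_mult, Cmod_weight, Cmod_R, Rabs_pos_eq by (exact Hx || lra).
apply Rmult_le_compat_l; [lra|].
apply Rmult_le_compat_l; [apply pow_le, sqrt_pos|].
apply HM, rem_bounds. apply (omega_spec x Hx).
Qed.

End Expansion.

Theorem theorem4p3 :
  forall G : R -> C,
  continuous_on (fun x : R => 0 <= x <= 1) G ->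
  (forall x : R, 0 <= x < 1 / 2 ->
     G x = (alpha * G (2 * x)%R - 1 / 2)%C) ->
  (forall x : R, 1 / 2 <= x <= 1 ->
     G x = ((1 - alpha) * G (2 * x - 1)%R + 1 / 2)%C) ->
  forall x : R, 0 <= x <= 1 ->
  exists s : C,
    is_series
      (fun k : nat =>
         let n := S k in
         ((- (1)) ^ (1 - omega x n) * alpha ^ (n - 1 - q x (n - 1))
            * (1 - alpha) ^ q x (n - 1))%C) s /\
    G x = (1 / 2 * s)%C.
Proof.
intros G HG G_left G_right x Hx.
destruct (continuous_on_interval_bounded (V := C_NormedModule) G 0 1)
  as [M HM]; [lra|exact HG|].
exists (2 * G x)%C. split; [|field].
apply (is_series_ext
  (fun k => (- (1)) ^ (1 - omega x (S k)) * weight x k)%C).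
- intros k. unfold weight. cbv zeta.
  replace (S k - 1)%nat with k by lia.
  match goal with |- ?l = ?r => change (@eq C l r) end. ring.
- exact (expansion_series G G_left G_right M x HM Hx).
Qed.
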